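(* Let $H$ be a Hopf monoid in a braided monoidal category $\mathbf{C}$ with comultiplication $\Delta$ and counit $\varepsilon$. For $n\ge 0$ let $\mathbf{O}_n$ be the set of comonoid morphisms $H^{\otimes n}\to H$, and for $\varphi\in\mathbf{O}_m$, $\psi_1,\ldots,\psi_m\in\mathbf{O}_n$ put $$\varphi\bullet(\psi_1,\ldots,\psi_m):=\varphi\circ(\psi_1\otimes\cdots\otimes\psi_m)\circ\Delta^{m-1}_{H^{\otimes n}},\qquad \pi_{i,n}:=\varepsilon\otimes\cdots\otimes\varepsilon\otimes\mathrm{id}_H\otimes\varepsilon\otimes\cdots\otimes\varepsilon$$ (with $\mathrm{id}_H$ in position $i$ of $n$). Then $\bullet$ and the $\pi_{i,n}$ turn the endomorphism operad $\{\mathbf{O}_n\}_{n\in\mathbb{N}}$ of $H$ in $\mathrm{Com}(\mathbf{C})$ into a clone if and only if $H$ is cocommutative.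
   Context: All monoidal categories are assumed strict. A braiding on $\mathbf{C}$ is a natural isomorphism $\sigma_{X,Y}\colon X\otimes Y\to Y\otimes X$ with $\sigma_{X\otimes Y,Z}=(\sigma_{X,Z}\otimes\mathrm{id}_Y)\circ(\mathrm{id}_X\otimes\sigma_{Y,Z})$ and $\sigma_{X,Y\otimes Z}=(\mathrm{id}_Y\otimes\sigma_{X,Z})\circ(\sigma_{X,Y}\otimes\mathrm{id}_Z)$ (not assumed symmetric). A comonoid $(X,\Delta_X,\varepsilon_X)$ is a counital coassociative object; it is cocommutative if $\sigma_{X,X}\circ\Delta_X=\Delta_X$. Comonoid morphisms are morphisms compatible with comultiplications and counits. $\mathrm{Com}(\mathbf{C})$ is the category of comonoids; it is monoidal, with $\varepsilon_{X\otimes Y}=\varepsilon_X\otimes\varepsilon_Y$ and $\Delta_{X\otimes Y}=(\mathrm{id}_X\otimes\sigma_{X,Y}\otimes\mathrm{id}_Y)\circ(\Delta_X\otimes\Delta_Y)$. $\Delta_{H^{\otimes n}}$ denotes the resulting comultiplication of $H^{\otimes n}$ and $\Delta^{m-1}_{H^{\otimes n}}\colon H^{\otimes n}\to (H^{\otimes n})^{\otimes m}$ is obtained by applying it $m-1$ times (the identity for $m=1$, and the counit for $m=0$). A bimonoid in $\mathbf{C}$ is a monoid $(H,\mu,\eta)$ in the monoidal category $\mathrm{Com}(\mathbf{C})$. A Hopf monoid is a bimonoid for which $\mathrm{id}_H$ is invertible in the monoid $\mathbf{C}(H,H)$ with convolution product $\varphi\diamond\psi=\mu\circ(\varphi\otimes\psi)\circ\Delta$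 and unit $\eta\circ\varepsilon$. A clone is a collection of sets $\{C_n\}_{n\in\mathbb{N}}$ with elements $\pi_{i,n}\in C_n$ ($i=1,\ldots,n$) and maps $\bullet\colon C_m\times(C_n)^m\to C_n$ such that for all $\varphi\in C_m$, $\psi_1,\ldots,\psi_m\in C_n$, $\rho_1,\ldots,\rho_n\in C_l$: (1) $\varphi\bullet(\pi_{1,m},\ldots,\pi_{m,m})=\varphi$; (2) $\pi_{i,m}\bullet(\psi_1,\ldots,\psi_m)=\psi_i$; (3) $\varphi\bullet(\psi_1\bullet(\rho_1,\ldots,\rho_n),\ldots,\psi_m\bullet(\rho_1,\ldots,\rho_n))=(\varphi\bullet(\psi_1,\ldots,\psi_m))\bullet(\rho_1,\ldots,\rho_n)$. Being a clone thus includes that every $\varphi\bullet(\psi_1,\ldots,\psi_m)$ again lies in $\mathbf{O}_n$. *)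

(* Defs.v *)
From mathcomp Require Import all_boot.
From Stdlib Require Import ProofIrrelevance ClassicalEpsilon.

Set Implicit Arguments.
Unset Strict Implicit.
Unset Printing Implicit Defensive.

Declare Scope obj_scope.
Declare Scope hom_scope.
Delimit Scope obj_scope with obj.
Delimit Scope hom_scope with hom.
Local Open Scope hom_scope.

Record category := Category {
  ob :> Type;
  hom : ob -> ob -> Type;
  idm : forall X, hom X X;
  comp : forall X Y Z, hom Y Z -> hom X Y -> hom X Z;
  comp1m : forall X Y (f : hom X Y), comp (idm Y) f = f;
  compm1 : forall X Y (f : hom X Y), comp f (idm X) = f;
  compA : forall X Y Z W (h : hom Z W) (g : hom Y Z) (f : hom X Y),
    comp h (comp g f) = comp (comp h g) f
}.

Bind Scope obj_scope with ob.
Bind Scope hom_scope with hom.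
Arguments hom {C} (X Y)%_obj_scope : rename.
Arguments idm {C} X%_obj_scope : rename.
Arguments comp {C} {X Y Z}%_obj_scope (g f)%_hom_scope : rename.

Notation "g ∘ f" := (comp g f) (at level 50, left associativity) : hom_scope.

(* The identity, seen as a morphism between two propositionally equal objects.
   In a strict monoidal category the associator and the unitors are of this
   form; between two given objects there is at most one such morphism. *)
Definition eqto (C : category) (X Y : C) (e : X = Y) : hom X Y :=
  match e in _ = Z return hom X Z with erefl => idm X end.

Record monoidal := Monoidal {
  cat :> category;
  tens : cat -> cat -> cat;
  unit : cat;
  tensm : forall X X' Y Y' : cat,
    hom X X' -> hom Y Y' -> hom (tens X Y) (tens X' Y');
  tensm_id : forall X Y, tensm (idm X) (idm Y) = idm (tens X Y);
  tensm_comp : forall X X' X'' Y Y' Y''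
      (g : hom X' X'') (f : hom X X') (g' : hom Y' Y'') (f' : hom Y Y'),
    tensm (g ∘ f) (g' ∘ f') = tensm g g' ∘ tensm f f';
  tensA : forall X Y Z, tens (tens X Y) Z = tens X (tens Y Z);
  tens1o : forall X, tens unit X = X;
  tenso1 : forall X, tens X unit = X;
  tensmA : forall X X' Y Y' Z Z'
      (f : hom X X') (g : hom Y Y') (h : hom Z Z'),
    eqto (tensA X' Y' Z') ∘ tensm (tensm f g) h
      = tensm f (tensm g h) ∘ eqto (tensA X Y Z);
  tensm1f : forall X X' (f : hom X X'),
    eqto (tens1o X') ∘ tensm (idm unit) f = f ∘ eqto (tens1o X);
  tensmf1 : forall X X' (f : hom X X'),
    eqto (tenso1 X') ∘ tensm f (idm unit) = f ∘ eqto (tenso1 X)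
}.

Arguments unit {C} : rename.
Arguments tens {C} (X Y)%_obj_scope : rename.
Arguments tensm {C} {X X' Y Y'}%_obj_scope (f g)%_hom_scope : rename.

Notation "X ⊗ Y" := (tens X Y) (at level 40, left associativity) : obj_scope.
Notation "f ⊗ g" := (tensm f g) (at level 40, left associativity) : hom_scope.

Record braided := Braided {
  moncat :> monoidal;
  braid : forall X Y : moncat, hom (X ⊗ Y) (Y ⊗ X);
  braid_nat : forall (X X' Y Y' : moncat) (f : hom X X') (g : hom Y Y'),
    braid X' Y' ∘ (f ⊗ g) = (g ⊗ f) ∘ braid X Y;
  braid_iso : forall X Y, exists s : hom (Y ⊗ X) (X ⊗ Y),
    s ∘ braid X Y = idm (X ⊗ Y) /\ braid X Y ∘ s = idm (Y ⊗ X);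
  braid_tensl : forall X Y Z,
    braid (X ⊗ Y) Z
      = eqto (tensA Z X Y) ∘ (braid X Z ⊗ idm Y)
          ∘ eqto (esym (tensA X Z Y)) ∘ (idm X ⊗ braid Y Z)
          ∘ eqto (tensA X Y Z);
  braid_tensr : forall X Y Z,
    braid X (Y ⊗ Z)
      = eqto (esym (tensA Y Z X)) ∘ (idm Y ⊗ braid X Z)
          ∘ eqto (tensA Y X Z) ∘ (braid X Y ⊗ idm Z)
          ∘ eqto (esym (tensA X Y Z))
}.

Arguments braid {C} (X Y)%_obj_scope : rename.

Fixpoint tpow (C : monoidal) (X : C) (n : nat) : C :=
  if n is k.+1 then (X ⊗ tpow X k)%obj else unit.

Fixpoint tensm_fam (C : monoidal) (X Y : C) (m : nat) :
    ('I_m -> hom X Y) -> hom (tpow X m) (tpow Y m) :=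
  match m with
  | 0 => fun=> idm unit
  | k.+1 => fun f => f ord0 ⊗ tensm_fam (fun i => f (lift ord0 i))
  end.

Record monoid (D : monoidal) := Monoid {
  mon_ob :> D;
  mu : hom (mon_ob ⊗ mon_ob) mon_ob;
  eta : hom unit mon_ob;
  muA : mu ∘ (mu ⊗ idm mon_ob)
          = mu ∘ (idm mon_ob ⊗ mu) ∘ eqto (tensA mon_ob mon_ob mon_ob);
  mu1m : mu ∘ (eta ⊗ idm mon_ob) = eqto (tens1o mon_ob);
  mum1 : mu ∘ (idm mon_ob ⊗ eta) = eqto (tenso1 mon_ob)
}.

Arguments mu {D} m : rename.
Arguments eta {D} m : rename.

Record comonoid (C : monoidal) := Comonoid {
  com_ob :> C;
  Delta : hom com_ob (com_ob ⊗ com_ob);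
  eps : hom com_ob unit;
  DeltaA : eqto (tensA com_ob com_ob com_ob) ∘ (Delta ⊗ idm com_ob) ∘ Delta
             = (idm com_ob ⊗ Delta) ∘ Delta;
  eps1m : eqto (tens1o com_ob) ∘ (eps ⊗ idm com_ob) ∘ Delta = idm com_ob;
  epsm1 : eqto (tenso1 com_ob) ∘ (idm com_ob ⊗ eps) ∘ Delta = idm com_ob
}.

Arguments Delta {C} X : rename.
Arguments eps {C} X : rename.

Definition is_comonoid_hom (C : monoidal) (X Y : comonoid C) (f : hom X Y) :=
  Delta Y ∘ f = (f ⊗ f) ∘ Delta X /\ eps Y ∘ f = eps X.

Record comonoid_hom (C : monoidal) (X Y : comonoid C) := ComonoidHom {
  com_mor :> hom X Y;
  com_morP : is_comonoid_hom com_mor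
}.

Definition cocommutative (C : braided) (X : comonoid C) : Prop :=
  braid X X ∘ Delta X = Delta X.

(* Arrows bundled with their domain and codomain: on them, strictness of the
   tensor product becomes plain equality. Only used in proofs. *)

Lemma eqto_id (C : category) (X : C) (e : X = X) : eqto e = idm X.
Proof. by rewrite (proof_irrelevance _ e erefl). Qed.

Record arr (C : category) := Arr { adom : C; acod : C; amor : hom adom acod }.

Definition aid (C : category) (X : C) := Arr (idm X).

Definition acomp (C : category) (g f : arr C) : arr C :=
  match excluded_middle_informative (acod f = adom g) with
  | left e => Arr (amor g ∘ eqto e ∘ amor f)
  | right _ => f
  end.

Definition atens (C : monoidal) (f g : arr C) : arr C :=
  Arr (amor f ⊗ amor g).

Declare Scope arr_scope.
Delimit Scope arr_scope with arr.
Notation "g @ f" := (acomp g f) (at level 50, left associativity) : arr_scope.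
Notation "f # g" := (atens f g) (at level 40, left associativity) : arr_scope.
Local Open Scope arr_scope.

Section ArrCat.
Variable C : category.
Implicit Types (X Y Z : C) (f g h : arr C).

Lemma Arr_inj X Y (f g : hom X Y) : Arr f = Arr g -> f = g.
Proof.
have K (a b : arr C) : a = b ->
    exists (e : adom a = adom b) (e' : acod a = acod b),
      eqto e' ∘ amor a = amor b ∘ eqto e.
  by move=> ->; exists erefl, erefl; rewrite /= comp1m compm1.
by move=> /K[e [e' /=]]; rewrite !eqto_id comp1m compm1.
Qed.

Lemma Arr_comp X Y Z (g : hom Y Z) (f : hom X Y) : Arr (g ∘ f) = Arr g @ Arr f.
Proof.
rewrite /acomp /=; case: excluded_middle_informative => [e|//].
by rewrite eqto_id compm1.
Qed.

Lemma Arr_id X : Arr (idm X) = aid X. Proof. by []. Qed.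

Lemma Arr_eqto X Y (e : X = Y) : Arr (eqto e) = aid X.
Proof. by case: _ / e. Qed.

Lemma Arr_eqtol X Y Z (e : Y = Z) (f : hom X Y) : Arr (eqto e ∘ f) = Arr f.
Proof. by case: _ / e; rewrite comp1m. Qed.

Lemma Arr_eqtor X Y Z (e : X = Y) (f : hom Y Z) : Arr (f ∘ eqto e) = Arr f.
Proof. by subst; rewrite compm1. Qed.

Lemma adom_comp g f : adom (g @ f) = adom f.
Proof. by rewrite /acomp; case: excluded_middle_informative. Qed.

Lemma acod_comp g f : acod f = adom g -> acod (g @ f) = acod g.
Proof. by rewrite /acomp; case: excluded_middle_informative. Qed.

Lemma acompA h g f : acod f = adom g -> acod g = adom h ->
  h @ (g @ f) = (h @ g) @ f.
Proof.
case: h g f => [A B h] [A' B' g] [A'' B'' f] /= e e'; subst.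
by rewrite -!Arr_comp compA.
Qed.

Lemma acomp_swap (q r t q' r' : arr C) : q @ r = q' @ r' ->
    acod t = adom r -> acod r = adom q -> acod r' = adom q' ->
  q @ (r @ t) = q' @ (r' @ t).
Proof.
move=> E e1 e2 e3; have e4 : adom r = adom r' by rewrite -(adom_comp q) E adom_comp.
by rewrite !acompA ?E // -?e4.
Qed.

Lemma acomp1f X f : acod f = X -> aid X @ f = f.
Proof. by case: f => A B f /= e; subst; rewrite -Arr_comp comp1m. Qed.

Lemma acompf1 X f : adom f = X -> f @ aid X = f.
Proof. by case: f => A B f /= e; subst; rewrite -Arr_comp compm1. Qed.

End ArrCat.

Section ArrMon.
Variable C : monoidal.
Implicit Types (X Y Z : C) (f g h : arr C).

Lemma Arr_tens X X' Y Y' (f : hom X X') (g : hom Y Y') :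
  Arr (f ⊗ g) = Arr f # Arr g.
Proof. by []. Qed.

Lemma Arr_conj (X X' Y Y' : C) (f : hom X Y) (g : hom X' Y')
    (e : X = X') (e' : Y = Y') :
  eqto e' ∘ f = g ∘ eqto e -> Arr f = Arr g.
Proof. by subst; rewrite /= comp1m compm1 => ->. Qed.

Lemma atensA f g h : (f # g) # h = f # (g # h).
Proof. exact: Arr_conj (tensmA _ _ _). Qed.

Lemma atens1f f : aid unit # f = f.
Proof. by case: f => X Y f; exact: Arr_conj (tensm1f f). Qed.

Lemma atensf1 f : f # aid unit = f.
Proof. by case: f => X Y f; exact: Arr_conj (tensmf1 f). Qed.

Lemma atens_id X Y : aid (X ⊗ Y) = aid X # aid Y.
Proof. by rewrite /aid /atens /= tensm_id. Qed.

Lemma atens_comp g f g' f' : acod f = adom g -> acod f' = adom g' ->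
  (g @ f) # (g' @ f') = (g # g') @ (f # f').
Proof.
case: g f g' f' => [A B g] [A' B' f] [D E g'] [D' E' f'] /= e e'; subst.
by rewrite -!Arr_comp /atens /= tensm_comp.
Qed.

Lemma adom_tens f g : adom (f # g) = (adom f ⊗ adom g)%obj. Proof. by []. Qed.
Lemma acod_tens f g : acod (f # g) = (acod f ⊗ acod g)%obj. Proof. by []. Qed.

End ArrMon.

Section TensorComonoid.
Variable C : braided.

Lemma tens_mid (X Y Z W : C) :
  ((X ⊗ Y) ⊗ (Z ⊗ W) = X ⊗ ((Y ⊗ Z) ⊗ W))%obj.
Proof. by rewrite !tensA. Qed.

(* [id ⊗ σ ⊗ id] on four factors *)
Definition mid_braid (X Y Z W : C) : hom ((X ⊗ Y) ⊗ (Z ⊗ W)) ((X ⊗ Z) ⊗ (Y ⊗ W))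
  := eqto (esym (tens_mid X Z Y W)) ∘ (idm X ⊗ (braid Y Z ⊗ idm W))
       ∘ eqto (tens_mid X Y Z W).

Definition tens_Delta (X Y : comonoid C) :
    hom (X ⊗ Y) ((X ⊗ Y) ⊗ (X ⊗ Y)) :=
  mid_braid X X Y Y ∘ (Delta X ⊗ Delta Y).

Definition tens_eps (X Y : comonoid C) : hom (X ⊗ Y) (unit : C) :=
  eqto (tens1o unit) ∘ (eps X ⊗ eps Y).

Definition unit_Delta : hom (unit : C) (unit ⊗ unit) := eqto (esym (tens1o unit)).

Notation s X Y := (Arr (braid (C := C) X Y)).

Lemma Arr_mid_braid X Y Z W : Arr (mid_braid X Y Z W) = aid X # s Y Z # aid W.
Proof. by rewrite Arr_eqtor Arr_eqtol atensA. Qed.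

Lemma Arr_tens_Delta X Y :
  Arr (tens_Delta X Y)
    = (aid (com_ob X) # s X Y # aid (com_ob Y)) @ (Arr (Delta X) # Arr (Delta Y)).
Proof. by rewrite Arr_comp Arr_mid_braid. Qed.

Lemma Arr_tens_eps X Y : Arr (tens_eps X Y) = Arr (eps X) # Arr (eps Y).
Proof. by rewrite Arr_eqtol. Qed.

Lemma s_nat (f g : arr C) :
  s (acod f) (acod g) @ (f # g) = (g # f) @ s (adom f) (adom g).
Proof.
case: f g => [A B f] [D E g].
by rewrite -!Arr_tens /= -!Arr_comp braid_nat.
Qed.

Lemma s_tensl (X Y Z : C) :
  s (X ⊗ Y)%obj Z = (s X Z # aid Y) @ (aid X # s Y Z).
Proof.
by rewrite braid_tensl Arr_eqtor -!compA Arr_eqtol Arr_comp Arr_eqtol.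
Qed.

Lemma s_tensr (X Y Z : C) :
  s X (Y ⊗ Z)%obj = (aid Y # s X Z) @ (s X Y # aid Z).
Proof.
by rewrite braid_tensr Arr_eqtor -!compA Arr_eqtol Arr_comp Arr_eqtol.
Qed.

Lemma s_unitl (X : C) : s unit X = aid X.
Proof.
have K (I : C) : I = unit -> s I X = s unit X by move=> ->.
have [t [ts _]] := braid_iso (unit : C) X.
have E : s unit X = s unit X @ s unit X.
  by rewrite -{1}(K _ (tens1o _)) s_tensl atensf1 atens1f.
have tE : Arr t @ s unit X = aid X by rewrite -Arr_comp ts Arr_id atens_id atens1f.
have := congr1 (acomp (Arr t)) E.
rewrite acompA /= ?tens1o ?tenso1 // tE => ->.
by rewrite acomp1f //= ?tens1o ?tenso1.
Qed.

Lemma s_unitr (X : C) : s X unit = aid X.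
Proof.
have K (I : C) : I = unit -> s X I = s X unit by move=> ->.
have [t [ts _]] := braid_iso X (unit : C).
have E : s X unit = s X unit @ s X unit.
  by rewrite -{1}(K _ (tens1o _)) s_tensr atensf1 atens1f.
have tE : Arr t @ s X unit = aid X by rewrite -Arr_comp ts Arr_id atens_id atensf1.
have := congr1 (acomp (Arr t)) E.
rewrite acompA /= ?tens1o ?tenso1 // tE => ->.
by rewrite acomp1f //= ?tens1o ?tenso1.
Qed.

Lemma acomp2 (a a' b b' : arr C) : acod a' = adom a -> acod b' = adom b ->
  (a # b) @ (a' # b') = (a @ a') # (b @ b').
Proof. by move=> *; rewrite atens_comp. Qed.

Lemma acomp3 (a a' b b' c c' : arr C) :
  acod a' = adom a -> acod b' = adom b -> acod c' = adom c ->
  (a # (b # c)) @ (a' # (b' # c')) = (a @ a') # ((b @ b') # (c @ c')).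
Proof. by move=> Ha Hb Hc; rewrite !atens_comp //= Hb Hc. Qed.

Lemma arr_coass (X : comonoid C) :
  (Arr (Delta X) # aid (com_ob X)) @ Arr (Delta X)
    = (aid (com_ob X) # Arr (Delta X)) @ Arr (Delta X).
Proof.
by have := congr1 (@Arr C _ _) (DeltaA X); rewrite -compA Arr_eqtol !Arr_comp.
Qed.

Lemma arr_counitl (X : comonoid C) :
  (Arr (eps X) # aid (com_ob X)) @ Arr (Delta X) = aid (com_ob X).
Proof.
by have := congr1 (@Arr C _ _) (eps1m X); rewrite -compA Arr_eqtol !Arr_comp.
Qed.

Lemma arr_counitr (X : comonoid C) :
  (aid (com_ob X) # Arr (eps X)) @ Arr (Delta X) = aid (com_ob X).
Proof.
by have := congr1 (@Arr C _ _) (epsm1 X); rewrite -compA Arr_eqtol !Arr_comp.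
Qed.

Lemma tens_DeltaA X Y :
  eqto (tensA _ _ _) ∘ (tens_Delta X Y ⊗ idm _) ∘ tens_Delta X Y
    = (idm _ ⊗ tens_Delta X Y) ∘ tens_Delta X Y.
Proof.
have := Arr_tens_Delta X Y; move: (tens_Delta X Y) => D DE.
apply: Arr_inj; rewrite -compA Arr_eqtol !Arr_comp !Arr_tens DE Arr_id atens_id.
set x := aid (com_ob X); set y := aid (com_ob Y); set s0 := s X Y.
set d := Arr (Delta X); set e := Arr (Delta Y).
have dA : (d # x) @ d = (x # d) @ d := arr_coass X.
have eA : (e # y) @ e = (y # e) @ e := arr_coass Y.
have xx f : acod f = X -> x @ f = f by exact: acomp1f.
have yy f : acod f = Y -> y @ f = f by exact: acomp1f.
have fx f : adom f = X -> f @ x = f by exact: acompf1.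
have fy f : adom f = Y -> f @ y = f by exact: acompf1.
have idxy : (x # y) @ (x # y) = x # y by rewrite acomp2 // xx // yy.
have -> : ((x # s0 # y) @ (d # e)) # (x # y)
        = (x # (s0 # (y # (x # y)))) @ (d # (e # (x # y))).
  by rewrite -{1}idxy atens_comp //= ?tensA // ?atensA.
have -> : (x # y) # ((x # s0 # y) @ (d # e))
        = (x # (y # (x # (s0 # y)))) @ (x # (y # (d # e))).
  by rewrite -{1}idxy atens_comp //= ?tensA // ?atensA.
rewrite (atensA x s0 y).
have xxd : (x # x) @ d = d by rewrite -atens_id acomp1f.
have yye : (y # y) @ e = e by rewrite -atens_id acomp1f.
have L1 : (d # (e # (x # y))) @ (x # (s0 # y))
        = (x # (x # (s X (Y ⊗ Y)%obj # y))) @ (d # (x # (e # y))).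
  rewrite -(atensA e x y) acomp3 // fx // yy // -(atensA x x) -(atensA x e y).
  by rewrite acomp3 // xxd yy // -(s_nat x e).
have R1 : (x # (y # (d # e))) @ (x # (s0 # y))
        = (x # (s (X ⊗ X)%obj Y # (y # y))) @ (x # (d # (y # e))).
  rewrite -(atensA y d e) acomp3 // xx // fy // -(atensA d y e).
  by rewrite acomp3 // xx // yye -(s_nat d y).
have dE : (d # (x # (e # y))) @ (d # e) = ((x # d) @ d) # ((e # y) @ e).
  by rewrite -dA -(atensA d x) acomp2.
have eE : (x # (d # (y # e))) @ (d # e) = ((x # d) @ d) # ((e # y) @ e).
  by rewrite eA -(atensA x d) acomp2.
have S1 : (x # (s0 # (y # (x # y)))) @ (x # (x # (s X (Y ⊗ Y)%obj # y)))
        = (x # (y # (x # (s0 # y)))) @ (x # (s (X ⊗ X)%obj Y # (y # y))).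
  have ss : (s0 # (y # x)) @ (x # y # s0) = s0 # s0.
    by rewrite -!atens_id acomp2 ?acompf1 ?acomp1f.
  have ss' : (y # x # s0) @ (s0 # (x # y)) = s0 # s0.
    by rewrite -!atens_id acomp2 ?acompf1 ?acomp1f.
  rewrite s_tensl s_tensr -/x -/y -/s0.
  transitivity (x # (((s0 # s0) @ (x # (s0 # y))) # y)).
    have -> : s0 # (y # (x # y)) = s0 # (y # x) # y by rewrite !atensA.
    rewrite -(atensA x (_ @ _) y) acomp3 //; last first.
      by rewrite /= acod_comp //= !tensA.
    congr (_ # (_ # _)); rewrite ?xx ?yy // -{2}(xx x) // atens_comp //= ?tensA //.
    by rewrite acompA /= ?tensA // -(atensA x) ss.
  have -> : y # (x # (s0 # y)) = y # x # s0 # y by rewrite !atensA.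
  rewrite -(atensA (_ @ _) y y) acomp3 //; last first.
    by rewrite /= acod_comp //= !tensA.
  congr (_ # (_ # _)); rewrite ?xx ?yy // -{3}(yy y) // atens_comp //= ?tensA //.
  by rewrite acompA /= ?tensA // (atensA s0) ss' (atensA x).
rewrite -!acompA //=; try by rewrite acod_comp //= !tensA.
rewrite (acomp_swap L1) //= ?tensA // (acomp_swap R1) //= ?tensA //.
rewrite (acomp_swap S1) ?acod_comp ?adom_comp //= ?tensA //.
by rewrite dE eE.
all: by rewrite !tensA.
Qed.

Lemma tens_eps1m X Y :
  eqto (tens1o _) ∘ (tens_eps X Y ⊗ idm _) ∘ tens_Delta X Y = idm (X ⊗ Y).
Proof.
have := Arr_tens_Delta X Y; move: (tens_Delta X Y) => D DE.
have := Arr_tens_eps X Y; move: (tens_eps X Y) => u uE.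
apply: Arr_inj; rewrite -compA Arr_eqtol !Arr_comp !Arr_tens DE uE Arr_id atens_id.
have xE := arr_counitl X; have yE := arr_counitl Y.
set x := aid (com_ob X) in xE *; set y := aid (com_ob Y) in yE *; set s0 := s X Y.
set d := Arr (Delta X) in xE *; set e := Arr (Delta Y) in yE *.
set f := Arr (eps X) in xE *; set g := Arr (eps Y) in yE *.
have -> : f # g # (x # y) = f # (g # x # y) by rewrite !atensA.
rewrite (atensA x s0 y) acompA //= ?tensA // acomp3 //.
rewrite -(s_nat x g) s_unitr acomp1f //= ?tens1o ?tenso1 //.
rewrite acompf1 // acomp1f // (atensA x g y) -(atensA f x).
by rewrite acomp2 // xE yE.
Qed.

Lemma tens_epsm1 X Y :
  eqto (tenso1 _) ∘ (idm _ ⊗ tens_eps X Y) ∘ tens_Delta X Y = idm (X ⊗ Y).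
Proof.
have := Arr_tens_Delta X Y; move: (tens_Delta X Y) => D DE.
have := Arr_tens_eps X Y; move: (tens_eps X Y) => u uE.
apply: Arr_inj; rewrite -compA Arr_eqtol !Arr_comp !Arr_tens DE uE Arr_id atens_id.
have xE := arr_counitr X; have yE := arr_counitr Y.
set x := aid (com_ob X) in xE *; set y := aid (com_ob Y) in yE *; set s0 := s X Y.
set d := Arr (Delta X) in xE *; set e := Arr (Delta Y) in yE *.
set f := Arr (eps X) in xE *; set g := Arr (eps Y) in yE *.
have -> : x # y # (f # g) = x # (y # f # g) by rewrite !atensA.
rewrite (atensA x s0 y) acompA //= ?tensA // acomp3 //.
rewrite -(s_nat f y) s_unitl acomp1f //= ?tens1o ?tenso1 //.
rewrite acompf1 // acompf1 // (atensA f y g) -(atensA x f).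
by rewrite acomp2 // xE yE.
Qed.

Definition tens_com (X Y : comonoid C) : comonoid C :=
  Comonoid (tens_DeltaA X Y) (tens_eps1m X Y) (tens_epsm1 X Y).

Lemma unit_DeltaA :
  eqto (tensA unit unit unit) ∘ (unit_Delta ⊗ idm unit) ∘ unit_Delta
    = (idm unit ⊗ unit_Delta) ∘ unit_Delta.
Proof.
apply: Arr_inj; rewrite -compA Arr_eqtol !Arr_comp !Arr_tens.
by rewrite atensf1 atens1f.
Qed.

Lemma unit_eps1m :
  eqto (tens1o (unit : C)) ∘ (idm unit ⊗ idm unit) ∘ unit_Delta = idm unit.
Proof.
apply: Arr_inj; rewrite -compA Arr_eqtol !Arr_comp !Arr_tens.
by rewrite atensf1 Arr_eqto acompf1 /= ?tens1o.
Qed.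

Lemma unit_epsm1 :
  eqto (tenso1 (unit : C)) ∘ (idm unit ⊗ idm unit) ∘ unit_Delta = idm unit.
Proof.
apply: Arr_inj; rewrite -compA Arr_eqtol !Arr_comp !Arr_tens.
by rewrite atensf1 Arr_eqto acompf1 /= ?tens1o.
Qed.

Definition unit_com : comonoid C :=
  Comonoid unit_DeltaA unit_eps1m unit_epsm1.

Lemma com_ext (X Y : comonoid C) :
  Arr (Delta X) = Arr (Delta Y) -> Arr (eps X) = Arr (eps Y) -> X = Y.
Proof.
case: X Y => [X D u a b c] [Y D' u' a' b' c'] /= ED Eu.
have /= EX := congr1 (@adom C) ED.
subst Y; move/Arr_inj: ED => ED; move/Arr_inj: Eu => Eu; subst.
by congr Comonoid; apply: proof_irrelevance.
Qed.

Lemma com_mor_inj (X Y : comonoid C) (f g : comonoid_hom X Y) :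
  com_mor f = com_mor g -> f = g.
Proof.
by case: f g => [f p] [g q] /= E; subst; congr ComonoidHom; apply: proof_irrelevance.
Qed.

Lemma id_com_subproof (X : comonoid C) : is_comonoid_hom (idm X).
Proof. by split; rewrite ?tensm_id ?comp1m compm1. Qed.

Definition id_com (X : comonoid C) : comonoid_hom X X :=
  ComonoidHom (id_com_subproof X).

Lemma comp_com_subproof (X Y Z : comonoid C)
    (g : comonoid_hom Y Z) (f : comonoid_hom X Y) :
  is_comonoid_hom (X := X) (Y := Z) (com_mor g ∘ com_mor f).
Proof.
case: g f => [g [gD ge]] [f [fD fe]]; split => /=.
  by rewrite compA gD -compA fD compA tensm_comp.
by rewrite compA ge.
Qed.

Definition comp_com (X Y Z : comonoid C)
    (g : comonoid_hom Y Z) (f : comonoid_hom X Y) : comonoid_hom X Z :=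
  ComonoidHom (comp_com_subproof g f).

Lemma comp1m_com (X Y : comonoid C) (f : comonoid_hom X Y) :
  comp_com (id_com Y) f = f.
Proof. by apply: com_mor_inj; exact: comp1m. Qed.

Lemma compm1_com (X Y : comonoid C) (f : comonoid_hom X Y) :
  comp_com f (id_com X) = f.
Proof. by apply: com_mor_inj; exact: compm1. Qed.

Lemma compA_com (X Y Z W : comonoid C) (h : comonoid_hom Z W)
    (g : comonoid_hom Y Z) (f : comonoid_hom X Y) :
  comp_com h (comp_com g f) = comp_com (comp_com h g) f.
Proof. by apply: com_mor_inj; exact: compA. Qed.

Definition com_cat : category := Category comp1m_com compm1_com compA_com.

Lemma tens_hom_subproof (X X' Y Y' : comonoid C)
    (f : comonoid_hom X X') (g : comonoid_hom Y Y') :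
  is_comonoid_hom (X := tens_com X Y) (Y := tens_com X' Y')
    (com_mor f ⊗ com_mor g).
Proof.
case: f g => [f [fD fe]] [g [gD ge]]; split => /=.
  have := Arr_tens_Delta X Y; move: (tens_Delta X Y) => D DE.
  have := Arr_tens_Delta X' Y'; move: (tens_Delta X' Y') => D' DE'.
  apply: Arr_inj; rewrite !Arr_comp !Arr_tens DE DE'.
  move/(congr1 (@Arr C _ _)): fD; move/(congr1 (@Arr C _ _)): gD.
  rewrite !Arr_comp !Arr_tens => gD fD.
  rewrite -acompA //= ?tensA // acomp2 // gD fD -acomp2 //.
  rewrite !acompA //= ?tensA //; congr (_ @ _).
  set a := Arr f; set b := Arr g.
  have -> : a # b # (a # b) = a # ((b # a) # b) by rewrite !atensA.
  rewrite (atensA (aid _)) -/a -/b.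
  have -> : a # a # (b # b) = a # ((a # b) # b) by rewrite !atensA.
  rewrite (atensA (aid _)) !acomp3 //.
  by rewrite (s_nat a b) !acomp1f ?acompf1.
have := Arr_tens_eps X Y; move: (tens_eps X Y) => D DE.
have := Arr_tens_eps X' Y'; move: (tens_eps X' Y') => D' DE'.
apply: Arr_inj; rewrite !Arr_comp !Arr_tens DE DE'.
move/(congr1 (@Arr C _ _)): fe; move/(congr1 (@Arr C _ _)): ge.
by rewrite !Arr_comp => ge fe; rewrite acomp2 // ge fe.
Qed.

Definition tens_hom (X X' Y Y' : com_cat) (f : hom X X') (g : hom Y Y') :
    hom (tens_com X Y : com_cat) (tens_com X' Y') :=
  ComonoidHom (tens_hom_subproof f g).

Lemma tens_hom_id (X Y : com_cat) :
  tens_hom (idm X) (idm Y) = idm (tens_com X Y : com_cat).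
Proof. by apply: com_mor_inj; exact: tensm_id. Qed.

Lemma tens_hom_comp (X X' X'' Y Y' Y'' : com_cat) (g : hom X' X'')
    (f : hom X X') (g' : hom Y' Y'') (f' : hom Y Y') :
  tens_hom (g ∘ f) (g' ∘ f') = tens_hom g g' ∘ tens_hom f f'.
Proof. by apply: com_mor_inj; exact: tensm_comp. Qed.

Lemma Arr_Delta_com X Y :
  Arr (Delta (tens_com X Y))
    = (aid (com_ob X) # s X Y # aid (com_ob Y)) @ (Arr (Delta X) # Arr (Delta Y)).
Proof. exact: Arr_tens_Delta. Qed.

Lemma Arr_eps_com X Y : Arr (eps (tens_com X Y)) = Arr (eps X) # Arr (eps Y).
Proof. exact: Arr_tens_eps. Qed.

Lemma tensA_com (X Y Z : comonoid C) :
  tens_com (tens_com X Y) Z = tens_com X (tens_com Y Z).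
Proof.
apply: com_ext; last by rewrite !Arr_eps_com atensA.
rewrite !Arr_Delta_com s_tensl s_tensr !atens_id.
set x := aid (com_ob X); set y := aid (com_ob Y); set z := aid (com_ob Z).
set d := Arr (Delta X); set e := Arr (Delta Y); set f := Arr (Delta Z).
set p := s X Y; set q := s X Z; set r := s Y Z.
have xx g : acod g = X -> x @ g = g by exact: acomp1f.
have yy g : acod g = Y -> y @ g = g by exact: acomp1f.
have zz g : acod g = Z -> z @ g = g by exact: acomp1f.
have fx g : adom g = X -> g @ x = g by exact: acompf1.
have fy g : adom g = Y -> g @ y = g by exact: acompf1.
have fz g : adom g = Z -> g @ z = g by exact: acompf1.
have xxd : (x # x) @ d = d by rewrite -atens_id acomp1f.
have zzf : (z # z) @ f = f by rewrite -atens_id acomp1f.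
have xyxy : (x # y) @ (x # y) = x # y by rewrite acomp2 // xx // yy.
have yzyz : (y # z) @ (y # z) = y # z by rewrite acomp2 // yy // zz.
have m1 : (y # x # r) @ (p # (y # z)) = p # r.
  by rewrite -!atens_id acomp2 // acomp1f // acompf1.
have m2 : (p # (z # y)) @ (x # y # r) = p # r.
  by rewrite -!atens_id acomp2 // acomp1f // acompf1.
transitivity ((x # (y # (q # (y # z)))) @ ((x # ((p # r) # z)) @ (d # (e # f)))).
  have -> : (x # y) # ((q # y) @ (x # r)) # z
      = (x # (y # (q # (y # z)))) @ (x # ((y # x # r) # z)).
    rewrite -{1}xyxy -(zz z) // atens_comp //= ?tensA // atens_comp //= ?tensA //.
    by rewrite zz // !atensA.
  have -> : ((x # p # y) @ (d # e)) # f
      = (x # ((p # (y # z)) # z)) @ (d # (e # f)).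
    by rewrite -{1}zzf atens_comp //= ?tensA // !atensA.
  rewrite -!acompA //=; try by rewrite ?acod_comp //= !tensA.
  congr (_ @ _); rewrite acompA //= ?tensA // acomp2 //= ?tensA // xx //.
  by rewrite (@acomp2 _ _ z z) //= ?tensA // m1 zz.
have -> : x # ((y # q) @ (p # z)) # (y # z)
    = (x # (y # (q # (y # z)))) @ (x # ((p # (z # y)) # z)).
  rewrite -{1}yzyz -{1}(xx x) // atens_comp //= ?tensA // atens_comp //= ?tensA //.
  by rewrite !atensA.
have -> : d # ((y # r # z) @ (e # f)) = (x # ((x # y # r) # z)) @ (d # (e # f)).
  by rewrite -{1}xxd atens_comp //= ?tensA // !atensA.
rewrite -!acompA //=; try by rewrite ?acod_comp //= !tensA.
congr (_ @ _); apply: esym; rewrite acompA //= ?tensA // acomp2 //= ?tensA // xx //.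
by rewrite (@acomp2 _ _ z z) //= ?tensA // m2 zz.
Qed.

Lemma tens1o_com (X : comonoid C) : tens_com unit_com X = X.
Proof.
apply: com_ext; last by rewrite Arr_eps_com atens1f.
rewrite Arr_Delta_com s_unitl (Arr_eqto _ : Arr (Delta unit_com) = _) !atens1f.
by rewrite -atens_id acomp1f.
Qed.

Lemma tenso1_com (X : comonoid C) : tens_com X unit_com = X.
Proof.
apply: com_ext; last by rewrite Arr_eps_com atensf1.
rewrite Arr_Delta_com s_unitr (Arr_eqto _ : Arr (Delta unit_com) = _) !atensf1.
by rewrite -atens_id acomp1f.
Qed.

Lemma Arr_com_eqto (X Y : com_cat) (e : X = Y) :
  Arr (com_mor (eqto e)) = aid (com_ob X).
Proof. by case: _ / e. Qed.

Lemma com_hom_eq (X Y X' Y' : com_cat) (f : hom X Y) (g : hom X' Y')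
    (e : X = X') (e' : Y = Y') :
  Arr (com_mor f) = Arr (com_mor g) -> eqto e' ∘ f = g ∘ eqto e.
Proof. by subst => /Arr_inj E; rewrite /= comp1m_com compm1_com; exact: com_mor_inj. Qed.

Lemma tens_homA (X X' Y Y' Z Z' : com_cat)
    (f : hom X X') (g : hom Y Y') (h : hom Z Z') :
  eqto (tensA_com X' Y' Z' : _ = _ :> com_cat) ∘ tens_hom (tens_hom f g) h
    = tens_hom f (tens_hom g h) ∘ eqto (tensA_com X Y Z : _ = _ :> com_cat).
Proof. by apply: com_hom_eq; rewrite !Arr_tens atensA. Qed.

Lemma tens_hom1f (X X' : com_cat) (f : hom X X') :
  eqto (tens1o_com X' : _ = _ :> com_cat) ∘ tens_hom (id_com unit_com) f
    = f ∘ eqto (tens1o_com X : _ = _ :> com_cat).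
Proof. by apply: com_hom_eq; rewrite Arr_tens atens1f. Qed.

Lemma tens_homf1 (X X' : com_cat) (f : hom X X') :
  eqto (tenso1_com X' : _ = _ :> com_cat) ∘ tens_hom f (id_com unit_com)
    = f ∘ eqto (tenso1_com X : _ = _ :> com_cat).
Proof. by apply: com_hom_eq; rewrite Arr_tens atensf1. Qed.

Definition Com : monoidal :=
  @Monoidal com_cat tens_com unit_com tens_hom tens_hom_id tens_hom_comp
    tensA_com tens1o_com tenso1_com tens_homA tens_hom1f tens_homf1.

End TensorComonoid.

Definition bimonoid (C : braided) := monoid (Com C).

Section Hopf.
Variables (C : braided) (H : bimonoid C).

Definition bim_com : comonoid C := mon_ob H.

Definition conv (f g : hom bim_com bim_com) : hom bim_com bim_com :=
  com_mor (mu H) ∘ (f ⊗ g) ∘ Delta bim_com.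

Definition conv_unit : hom bim_com bim_com := com_mor (eta H) ∘ eps bim_com.

Definition is_hopf : Prop :=
  exists S : hom bim_com bim_com,
    conv S (idm bim_com) = conv_unit /\ conv (idm bim_com) S = conv_unit.

End Hopf.

Record hopf_monoid (C : braided) := HopfMonoid {
  hopf_bim :> bimonoid C;
  hopfP : is_hopf hopf_bim
}.

Section Operad.
Variable C : braided.

(* [Δ^k : X -> X^{⊗(k+1)}] *)
Fixpoint Delta_iter (X : Com C) (k : nat) :
    hom (com_ob X) (com_ob (tpow X k.+1)) :=
  match k with
  | 0 => eqto (esym (tenso1 (com_ob X)))
  | k'.+1 => (idm (com_ob X) ⊗ Delta_iter X k') ∘ Delta X
  end.

(* [Δ^{m-1} : X -> X^{⊗m}], with [Δ^{-1} = ε] *)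
Definition Delta_pred (X : Com C) (m : nat) : hom (com_ob X) (com_ob (tpow X m)) :=
  match m with
  | 0 => eps X
  | k.+1 => Delta_iter X k
  end.

Definition endo (H : Com C) (n : nat) : Type := hom (tpow H n) H.

Definition superpose (H : Com C) (m n : nat)
    (phi : endo H m) (psi : 'I_m -> endo H n) : hom (com_ob (tpow H n)) (com_ob H) :=
  com_mor phi ∘ com_mor (tensm_fam psi) ∘ Delta_pred (tpow H n) m.

(* [ε ⊗ ... ⊗ id ⊗ ... ⊗ ε], by recursion on the number of factors; the tensor
   power of counits [ε ⊗ ... ⊗ ε] is the counit of [tpow H n]. *)
Fixpoint proj (H : Com C) (n : nat) :
    'I_n -> hom (com_ob (tpow H n)) (com_ob H) :=
  match n with
  | 0 => fun i => False_rect _ (notF (ltn_ord i))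
  | k.+1 => fun i =>
      match unlift ord0 i with
      | None => eqto (tenso1 (com_ob H)) ∘ (idm (com_ob H) ⊗ eps (tpow H k))
      | Some j => eqto (tens1o (com_ob H)) ∘ (eps H ⊗ proj H j)
      end
  end.

End Operad.

Record is_clone (O : nat -> Type) (pi : forall n, 'I_n -> O n)
    (bullet : forall m n, O m -> ('I_m -> O n) -> O n) : Prop := IsClone {
  clone_id : forall m (phi : O m), bullet m m phi (pi m) = phi;
  clone_proj : forall m n (i : 'I_m) (psi : 'I_m -> O n),
    bullet m n (pi m i) psi = psi i;
  clone_assoc : forall m n l (phi : O m) (psi : 'I_m -> O n) (rho : 'I_n -> O l),
    bullet m l phi (fun i => bullet n l (psi i) rho)
      = bullet n l (bullet m n phi psi) rho
}.

(* That [proj] and [superpose] land in the comonoid morphisms is part of the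
   statement: they must lift to operations on [endo H]. *)
Definition endo_is_clone (C : braided) (H : Com C) : Prop :=
  exists (pi : forall n, 'I_n -> endo H n)
         (bullet : forall m n, endo H m -> ('I_m -> endo H n) -> endo H n),
    [/\ forall n (i : 'I_n), com_mor (pi n i) = proj H i,
        forall m n (phi : endo H m) (psi : 'I_m -> endo H n),
          com_mor (bullet m n phi psi) = superpose phi psi
      & is_clone pi bullet].

(* Main.v *)
(* If the operad is a clone, then [μ ∘ Δ], which superposes the projections
   [H -> H] into [μ], is a comonoid morphism; in Sweedler notation
   [x1 x3 ⊗ x2 x4 = x1 x2 ⊗ x3 x4], and cancelling the two outer factors with
   the antipode gives [x2 ⊗ x1 = x1 ⊗ x2].
   Conversely, a tensor product of cocommutative comonoids need not be
   cocommutative when the braiding is not symmetric. However (Schauenburg), if H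
   is a cocommutative Hopf monoid, then [σ ∘ Δ ∘ μ = Δ ∘ μ], and the bialgebra
   axiom turns this into [(μ ⊗ μ)(1 ⊗ σ ⊗ 1)(Δ ⊗ Δ) = (μ ⊗ μ)(1 ⊗ σ^-1 ⊗ 1)(Δ ⊗ Δ)];
   the antipode cancels again and [σ = σ^-1] on [H ⊗ H]. Hence all [H^{⊗n}] are
   cocommutative, their iterated comultiplications are comonoid morphisms, and
   the clone axioms are those of tuples in a cartesian category. *)

From mathcomp Require Import all_boot.
Require Import Defs.

Set Implicit Arguments.
Unset Strict Implicit.
Unset Printing Implicit Defensive.

Local Open Scope hom_scope.
Local Open Scope arr_scope.

Local Notation s X Y := (Arr (@braid _ X Y)).
Local Notation d X := (Arr (Delta X)).

(* Solves equations between the domains and codomains of composites of arrows. *)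
Ltac arr_ty :=
  try done;
  repeat first
    [ progress rewrite ?adom_comp ?adom_tens ?acod_tens
    | rewrite acod_comp; [|solve [arr_ty]] ];
  solve [ by rewrite /= ?tensA ?tens1o ?tenso1 ].

(** * Double braidings and cocommutativity of tensor products *)

Section Braided.
Variable C : braided.
Implicit Types (X Y Z W : C) (f g : arr C).

Lemma atens_compl X f g : acod f = adom g ->
  aid X # (g @ f) = (aid X # g) @ (aid X # f).
Proof. by move=> e; rewrite acomp2 // acomp1f. Qed.

Lemma atens_compr X f g : acod f = adom g ->
  (g @ f) # aid X = (g # aid X) @ (f # aid X).
Proof. by move=> e; rewrite acomp2 // acomp1f. Qed.

Lemma atens_hcomp f g : f # g = (f # aid (acod g)) @ (aid (adom f) # g).
Proof. by rewrite acomp2 // acomp1f // acompf1. Qed.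

Lemma atens_hcompV f g : f # g = (aid (acod f) # g) @ (f # aid (adom g)).
Proof. by rewrite acomp2 // acomp1f // acompf1. Qed.

(** The crossing of the two inner factors comes first, so that it meets the inner braiding in the
    comultiplication of a tensor product. *)
Lemma s_tens X Y Z W :
  s (X ⊗ Y)%obj (Z ⊗ W)%obj
    = (aid Z # s X W # aid Y) @ (s X Z # s Y W) @ (aid X # s Y Z # aid W).
Proof.
rewrite s_tensl !s_tensr.
rewrite atens_compr; last by arr_ty.
rewrite atens_compl; last by arr_ty.
rewrite -!atensA.
rewrite [s X Z # s Y W]atens_hcomp /= !atens_id -!atensA.
rewrite !acompA //; by arr_ty.
Qed.

(** Müger's condition that two objects centralize each other: a symmetric braiding, asked of one
    pair only. *)
Definition transparent X Y := s Y X @ s X Y = aid (X ⊗ Y)%obj.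

Lemma transparent_tensr X Y Z :
  transparent X Y -> transparent X Z -> transparent X (Y ⊗ Z)%obj.
Proof.
rewrite /transparent => eY eZ; rewrite s_tensl s_tensr.
rewrite -acompA; try arr_ty.
rewrite (acompA (h := aid Y # s Z X)); try arr_ty.
rewrite -atens_compl; try arr_ty.
rewrite eZ atens_id -(atensA _ (aid X)) -!atens_id acomp1f; try arr_ty.
rewrite -atens_compr; try arr_ty.
by rewrite eY -atens_id tensA.
Qed.

Lemma transparent_unit X : transparent X unit.
Proof. by rewrite /transparent s_unitl s_unitr tenso1 acomp1f. Qed.

Lemma arr_cocommP (X : comonoid C) :
  cocommutative X <-> s X X @ Arr (Delta X) = Arr (Delta X).
Proof.
rewrite -Arr_comp; split => [-> //|]; exact: Arr_inj.
Qed.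

(** By [s_tens], the braiding and the comultiplication contribute a double braiding in the middle,
    which is trivial; the crossings [s X X # s Y Y] that remain on the left of it are absorbed first
    by the two comultiplications. *)
Lemma cocomm_tens (X Y : comonoid C) : transparent X Y ->
  cocommutative X -> cocommutative Y -> cocommutative (tens_com X Y).
Proof.
rewrite /transparent => eXY /arr_cocommP cX /arr_cocommP cY; apply/arr_cocommP.
rewrite Arr_Delta_com s_tens.
rewrite -acompA; try arr_ty.
rewrite (acompA (h := _ # s Y X # _)); try arr_ty.
rewrite -atens_compr; try arr_ty.
rewrite -atens_compl; try arr_ty.
rewrite eXY !atens_id !atensA -(atensA (aid X)) -!atens_id acomp1f; try arr_ty.
rewrite -acompA; try arr_ty.
by rewrite acomp2 // cX cY.
Qed.

Lemma cocomm_unit : cocommutative (unit_com C).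
Proof.
by apply/arr_cocommP; rewrite s_unitl acomp1f //= tens1o.
Qed.

(** * Counits and iterated comultiplications as comonoid morphisms *)

Lemma arr_homP (X Y : comonoid C) (f : hom X Y) :
  is_comonoid_hom f <->
  Arr (Delta Y) @ Arr f = (Arr f # Arr f) @ Arr (Delta X)
    /\ Arr (eps Y) @ Arr f = Arr (eps X).
Proof.
rewrite -!Arr_comp; split=> [[-> ->] //|[/Arr_inj ? /Arr_inj ?]].
by split.
Qed.

Lemma eps_com_hom (X : comonoid C) : is_comonoid_hom (Y := unit_com C) (eps X).
Proof.
apply/arr_homP; split; last by rewrite acomp1f.
rewrite (Arr_eqto _ : Arr (Delta (unit_com C)) = _) acomp1f //.
rewrite atens_hcompV -acompA //= arr_counitl.
by rewrite atens1f acompf1.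
Qed.

(** Exhibits the legs [x2 ⊗ x3] of the fourfold comultiplication as one comultiplication, on which a
    map between the middle factors can act. *)
Lemma arr_coass4 (X : comonoid C) :
  (d X # d X) @ d X
    = (aid (com_ob X) # d X # aid (com_ob X)) @ ((d X # aid (com_ob X)) @ d X).
Proof.
rewrite acompA; try arr_ty.
rewrite -atens_compr; try arr_ty.
rewrite -arr_coass atens_compr; try arr_ty.
rewrite -acompA; try arr_ty.
rewrite arr_coass acompA; try arr_ty.
by rewrite atensA -atens_id acomp2 // acomp1f // acompf1.
Qed.

Definition eps_hom (X : Com C) : hom X unit := ComonoidHom (eps_com_hom X).

Lemma Delta_com_hom (X : comonoid C) : cocommutative X ->
  is_comonoid_hom (Y := tens_com X X) (Delta X).
Proof.
move=> /arr_cocommP cX; apply/arr_homP; split; last first.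
  rewrite Arr_eps_com atens_hcompV -acompA //= arr_counitl.
  by rewrite atens1f acompf1.
rewrite Arr_Delta_com -acompA; try arr_ty.
rewrite arr_coass4 acompA; try arr_ty.
rewrite -!atens_compr; try arr_ty.
rewrite -!atens_compl; try arr_ty.
by rewrite cX.
Qed.

Lemma Delta_iter_com (X : Com C) k : cocommutative X ->
  is_comonoid_hom (Delta_iter X k).
Proof.
move=> cX; elim: k => [|k IH].
  (* The base case is an identity by strictness, hence underlies the corresponding identity of
     [Com C]. *)
  suff -> : Delta_iter X 0
    = com_mor (eqto (esym (tenso1_com X) : _ = _ :> com_cat C)).
    exact: com_morP.
  by apply: Arr_inj; rewrite Arr_eqto; exact: esym (Arr_com_eqto _).
pose f : hom X (X ⊗ X)%obj := ComonoidHom (Delta_com_hom cX).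
pose g : hom X (tpow X k.+1) := ComonoidHom IH.
exact: (com_morP ((idm X ⊗ g) ∘ f)).
Qed.

Lemma Delta_pred_com (X : Com C) m : cocommutative X ->
  is_comonoid_hom (Delta_pred X m).
Proof. by case: m => [|m] cX; [exact: eps_com_hom|exact: Delta_iter_com]. Qed.

Lemma transparent_tpow (X : Com C) n :
  transparent (com_ob X) (com_ob X) -> transparent (com_ob X) (com_ob (tpow X n)).
Proof.
move=> e; elim: n => [|n IH] /=; first exact: transparent_unit.
exact: transparent_tensr.
Qed.

Lemma cocomm_tpow (X : Com C) n :
  transparent (com_ob X) (com_ob X) -> cocommutative X ->
  cocommutative (tpow X n).
Proof.
move=> e cX; elim: n => [|n IH] /=; first exact: cocomm_unit.
by apply: cocomm_tens => //; exact: transparent_tpow.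
Qed.

(** * Tuples, projections and the clone axioms *)

(** The part of [superpose] that precedes [phi]. It is a morphism of [C] only, since its being one
    of [Com C] is derived from cocommutativity of [X]. *)
Definition tuple_hom (X Y : Com C) m (psi : 'I_m -> hom X Y) :
    hom (com_ob X) (com_ob (tpow Y m)) :=
  com_mor (tensm_fam psi) ∘ Delta_pred X m.

(** [Delta_pred] treats lengths 0 and 1 separately; the counit law reconciles them, so that
    inductions on tuples can start at length 0. *)
Lemma tuple_homS (X Y : Com C) m (psi : 'I_m.+1 -> hom X Y) :
  tuple_hom psi
    = (com_mor (psi ord0) ⊗ tuple_hom (fun i => psi (lift ord0 i))) ∘ Delta X.
Proof.
rewrite /tuple_hom /=; case: m psi => [|m] psi /=; last first.
  by rewrite -[com_mor (psi _)]compm1 tensm_comp compA compm1.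
apply: Arr_inj; rewrite comp1m Arr_eqtor Arr_comp /=.
rewrite !Arr_tens Arr_id atensf1 [Arr _ # Arr (eps X)]atens_hcomp /=.
rewrite -acompA; try arr_ty.
by rewrite arr_counitr atensf1 acompf1.
Qed.

Lemma Arr_tuple_homS (X Y : Com C) m (psi : 'I_m.+1 -> hom X Y) :
  Arr (tuple_hom psi)
    = (Arr (com_mor (psi ord0)) # Arr (tuple_hom (fun i => psi (lift ord0 i))))
        @ d X.
Proof. by rewrite tuple_homS Arr_comp. Qed.

Lemma tuple_hom0 (X Y : Com C) (psi : 'I_0 -> hom X Y) : tuple_hom psi = eps X.
Proof. exact: comp1m. Qed.

Lemma tuple_hom_com (X Y : Com C) m (psi : 'I_m -> hom X Y) :
  cocommutative X -> is_comonoid_hom (tuple_hom psi).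
Proof.
move=> cX; pose f : hom X (tpow X m) := ComonoidHom (Delta_pred_com m cX).
exact: (com_morP (tensm_fam psi ∘ f)).
Qed.

Lemma Arr_com_eqtol (X Y Z : Com C) (e : Y = Z) (f : hom X Y) :
  Arr (com_mor (eqto e ∘ f)) = Arr (com_mor f).
Proof. by case: _ / e => /=; rewrite comp1m. Qed.

Lemma Arr_com_eqtor (X Y Z : Com C) (e : X = Y) (f : hom Y Z) :
  Arr (com_mor (f ∘ eqto e)) = Arr (com_mor f).
Proof. by subst=> /=; rewrite compm1. Qed.

Lemma proj_com (X : Com C) n (i : 'I_n) : is_comonoid_hom (proj X i).
Proof.
elim: n i => [[]//|n IH i] /=; case: unliftP => [j|] _.
  pose p : hom (tpow X n) X := ComonoidHom (IH j).
  suff -> : eqto (tens1o (com_ob X)) ∘ (eps X ⊗ proj X j)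
    = com_mor (eqto (tens1o X) ∘ (eps_hom X ⊗ p)).
    exact: com_morP.
  apply: Arr_inj; rewrite Arr_eqtol.
  exact: esym (Arr_com_eqtol (tens1o X) (eps_hom X ⊗ p)).
suff -> : eqto (tenso1 (com_ob X)) ∘ (idm (com_ob X) ⊗ eps (tpow X n))
    = com_mor (eqto (tenso1 X) ∘ (idm X ⊗ eps_hom (tpow X n))).
    exact: com_morP.
apply: Arr_inj; rewrite Arr_eqtol.
exact: esym (Arr_com_eqtol (tenso1 X) (idm X ⊗ eps_hom (tpow X n))).
Qed.

(** The projection applies counits to the other components; these preserve counits, and the counit
    law of [X] removes what is left. *)
Lemma proj_tuple (X Y : Com C) m (psi : 'I_m -> hom X Y) i :
  cocommutative X -> proj Y i ∘ tuple_hom psi = com_mor (psi i).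
Proof.
move=> cX; elim: m psi i => [psi []//|m IH] psi i.
have [_ eps_tuple] := tuple_hom_com (fun j => psi (lift ord0 j)) cX.
rewrite tuple_homS /=; case: unliftP => [j|] ->.
  apply: Arr_inj; rewrite -compA Arr_eqtol compA -tensm_comp IH.
  have [_ ->] := com_morP (psi ord0).
  rewrite Arr_comp Arr_tens atens_hcompV -acompA //= arr_counitl.
  by rewrite atens1f acompf1.
apply: Arr_inj; rewrite -compA Arr_eqtol compA -tensm_comp eps_tuple comp1m.
rewrite Arr_comp Arr_tens atens_hcomp -acompA //= arr_counitr.
by rewrite atensf1 acompf1.
Qed.

(** A comonoid morphism slides through each comultiplication of the recursion. With [f] a tuple,
    this yields the third clone axiom. *)
Lemma tuple_comp (X Y Z : Com C) m (psi : 'I_m -> hom X Y) (psi' : 'I_m -> hom Z Y)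
    (f : hom (com_ob Z) (com_ob X)) :
  is_comonoid_hom f -> (forall i, com_mor (psi' i) = com_mor (psi i) ∘ f) ->
  tuple_hom psi' = tuple_hom psi ∘ f.
Proof.
move=> [fD fe]; elim: m psi psi' => [|m IH] psi psi' E.
  by rewrite /tuple_hom /= !comp1m fe.
rewrite !tuple_homS -compA fD compA -tensm_comp -E.
by rewrite (IH (fun j => psi (lift ord0 j))).
Qed.

Lemma tuple_proj (X : Com C) m (pi : 'I_m -> hom (tpow X m) X) :
  (forall i, com_mor (pi i) = proj X i) -> tuple_hom pi = idm (com_ob (tpow X m)).
Proof.
elim: m pi => [|m IH] pi E; first by rewrite /tuple_hom /= comp1m.
rewrite tuple_homS E.
pose pi' i : hom (tpow X m) X := ComonoidHom (proj_com X i).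
(* [f] discards the first factor; all projections but the first factor through it, so [tuple_comp]
   reduces the tail to the induction hypothesis. *)
pose f : hom (tpow X m.+1) (tpow X m) :=
  eqto (tens1o (tpow X m)) ∘ (eps_hom X ⊗ idm (tpow X m)).
have Arr_f : Arr (com_mor f) = Arr (eps X) # aid (com_ob (tpow X m)).
  exact: Arr_com_eqtol (tens1o _) (eps_hom X ⊗ idm (tpow X m)).
rewrite (@tuple_comp _ _ _ _ pi' _ (com_mor f)); last first.
- move=> i; rewrite E /= liftK /=; apply: Arr_inj.
  rewrite Arr_eqtol Arr_comp Arr_f Arr_tens.
  by rewrite [Arr (eps X) # Arr (proj X i)]atens_hcompV atens1f.
- exact: com_morP.
rewrite IH // comp1m /= unlift_none.
apply: Arr_inj; rewrite Arr_comp Arr_Delta_com Arr_tens Arr_f Arr_eqtol Arr_tens.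
rewrite !Arr_id atens_id acompA; try arr_ty.
rewrite !atensA -(atensA (Arr (eps (tpow X m)))) acomp3 //.
(* The two inner counits move past the braiding, which becomes a braiding of units and
   disappears. *)
rewrite -(s_nat (Arr (eps X)) (Arr (eps (tpow X m)))) s_unitl.
rewrite !acomp1f; try arr_ty.
rewrite atensA -(atensA (aid (com_ob X))) acomp2 //.
by rewrite arr_counitr arr_counitl.
Qed.

Lemma cocomm_clone (H : Com C) :
  transparent (com_ob H) (com_ob H) -> cocommutative H -> endo_is_clone H.
Proof.
move=> tH cH; have cHn n := cocomm_tpow n tH cH.
pose pi n i : endo H n := ComonoidHom (proj_com H i).
pose tup m n (psi : 'I_m -> endo H n) : hom (tpow H n) (tpow H m) :=
  ComonoidHom (tuple_hom_com psi (cHn n)).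
pose bullet m n (phi : endo H m) (psi : 'I_m -> endo H n) : endo H n :=
  phi ∘ tup m n psi.
exists pi, bullet; split=> // [m n phi psi|]; first by rewrite /superpose -compA.
split=> [m phi|m n i psi|m n l phi psi rho]; apply: com_mor_inj => /=.
- by rewrite (tuple_proj (pi := pi m)) // compm1.
- exact: proj_tuple.
- rewrite -compA; congr (_ ∘ _); apply: tuple_comp => //.
  exact: tuple_hom_com.
Qed.

End Braided.

(** * Hopf monoids: cancelling outer factors with the antipode *)

Section Hopf.
Variables (C : braided) (H : bimonoid C).
Local Notation X := (com_ob (bim_com H)).
Local Notation x := (aid X).
Local Notation sX := (s X X).
Local Notation dX := (Arr (Delta (bim_com H))).
Local Notation eX := (Arr (eps (bim_com H))).
Local Notation mX := (Arr (com_mor (mu H))).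
Local Notation uX := (Arr (com_mor (eta H))).

Lemma arr_mulA : mX @ (mX # x) = mX @ (x # mX).
Proof.
have := congr1 (fun f => Arr (com_mor f)) (muA H).
by rewrite Arr_com_eqtor /= !Arr_comp.
Qed.

Lemma arr_mul1x : mX @ (uX # x) = x.
Proof.
have := congr1 (fun f => Arr (com_mor f)) (mu1m H).
rewrite Arr_com_eqto /= !Arr_comp => E.
by rewrite (E : mX @ (uX # x) = _) atens_id atens1f.
Qed.

Lemma arr_mulx1 : mX @ (x # uX) = x.
Proof.
have := congr1 (fun f => Arr (com_mor f)) (mum1 H).
rewrite Arr_com_eqto /= !Arr_comp => E.
by rewrite (E : mX @ (x # uX) = _) atens_id atensf1.
Qed.

(* [x ⊗ y ↦ x1 a ⊗ b y2], where [a ⊗ b = f (x2 ⊗ y1)] *)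
Definition sandwich (f : arr C) : arr C :=
  (mX # mX) @ ((x # (f # x)) @ (dX # dX)).

Lemma arr_bialgebra : dX @ mX = sandwich sX.
Proof.
have [E _] := com_morP (mu H).
have {}E : dX @ mX = (mX # mX) @ Arr (Delta (tens_com (bim_com H) (bim_com H))).
  by rewrite -!Arr_comp E.
by rewrite E Arr_Delta_com atensA.
Qed.

(* [x ⊗ y ↦ S x1 a ⊗ b S y2], where [a ⊗ b = f (x2 ⊗ y1)] *)
Definition unsandwich (S f : arr C) : arr C :=
  (mX # mX) @ ((S # (f # S)) @ (dX # dX)).

Lemma adom_sandwich f : adom (sandwich f) = (X ⊗ X)%obj.
Proof. by rewrite !adom_comp. Qed.

Lemma acod_sandwich f : adom f = (X ⊗ X)%obj -> acod f = (X ⊗ X)%obj ->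
  acod (sandwich f) = (X ⊗ X)%obj.
Proof. by case: f => A B f /= eA eB; subst A B; rewrite /sandwich; arr_ty. Qed.

Section Antipode.
Variables (S : hom X X).
Hypotheses (SX : conv S (idm X) = conv_unit H) (XS : conv (idm X) S = conv_unit H).
Local Notation sS := (Arr S).

Lemma arr_antipodel : mX @ ((sS # x) @ dX) = uX @ eX.
Proof.
have := congr1 (@Arr C _ _) SX.
by rewrite !Arr_comp -acompA.
Qed.

Lemma arr_antipoder : mX @ ((x # sS) @ dX) = uX @ eX.
Proof.
have := congr1 (@Arr C _ _) XS.
by rewrite !Arr_comp -acompA.
Qed.

(** In Sweedler notation the left side is [S x1 x2 a ⊗ b y2 S y3] with [a ⊗ b = f (x3 ⊗ y1)], and
    both outer products collapse. *)
Lemma sandwichK f : adom f = (X ⊗ X)%obj -> acod f = (X ⊗ X)%obj ->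
  unsandwich sS (sandwich f) = f.
Proof.
case: f => A B f /= eA eB; subst A B; set g := Arr f.
rewrite /unsandwich /sandwich; set R := (x # (g # x)) @ (dX # dX).
have cR : acod R = (X ⊗ X ⊗ (X ⊗ X))%obj by rewrite /R; arr_ty.
have dR : adom R = (X ⊗ X)%obj by rewrite /R; arr_ty.
have -> : sS # (((mX # mX) @ R) # sS) = (x # ((mX # mX) # x)) @ (sS # (R # sS)).
  by rewrite acomp3 // !acomp1f.
have -> : sS # (R # sS) = (sS # ((x # (g # x)) # sS)) @ (x # ((dX # dX) # x)).
  by rewrite acomp3; try arr_ty; rewrite !acompf1.
rewrite -!acompA; try arr_ty.
rewrite -(atensA x (dX # dX)) -(atensA x dX) (atensA _ dX) acomp2 //.
(* Coassociativity regroups so that [x1 ⊗ x2] and [y2 ⊗ y3] each come from one comultiplication, as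
   the antipode laws require. *)
rewrite arr_coass -[X in X # ((x # dX) @ dX)]arr_coass -acomp2 //.
rewrite (acompA (f := dX # dX)); try arr_ty.
have -> : (sS # ((x # (g # x)) # sS)) @ ((dX # x) # (x # dX))
    = ((sS # x) @ dX) # (g # ((x # sS) @ dX)).
  rewrite (atensA dX) !atensA -(atensA sS x) -(atensA x x dX) acomp3 //.
  by rewrite -atens_id acompf1.
rewrite (acompA (g := x # ((mX # mX) # x))); try arr_ty.
have -> : (mX # mX) @ (x # ((mX # mX) # x)) = (mX # mX) @ (mX # (x # x # mX)).
  rewrite (atensA mX) -(atensA x mX) !(atensA x x) -(atensA mX x).
  by rewrite !acomp2 // arr_mulA.
rewrite -!acompA; try arr_ty.
rewrite (acompA (h := mX # (x # x # mX))); try arr_ty.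
rewrite acomp3; try arr_ty.
rewrite arr_antipodel arr_antipoder -atens_id acomp1f; try arr_ty.
have -> : (uX @ eX) # (g # (uX @ eX)) = (uX # (x # x # uX)) @ (eX # (g # eX)).
  by rewrite acomp3; try arr_ty; rewrite -atens_id acomp1f.
have -> : eX # (g # eX) = g @ (eX # (x # x # eX)).
  transitivity ((aid unit # (g # aid unit)) @ (eX # (x # x # eX))).
    by rewrite acomp3 // !acomp1f // -atens_id acompf1.
  by rewrite atens1f atensf1.
rewrite -!acompA; try arr_ty.
rewrite (acompA (h := mX # mX)); try arr_ty.
rewrite !(atensA x x) -(atensA eX) -(atensA uX) !acomp2 //.
rewrite arr_mul1x arr_mulx1 arr_counitl arr_counitr.
by rewrite -atens_id acomp1f ?acompf1.
Qed.

(** By [arr_coass4], the two arguments of [f] are the legs of one [dX]; thus the composite depends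
    on [f] only through [f @ dX]. *)
Lemma unsandwich_comp f : adom f = (X ⊗ X)%obj -> acod f = (X ⊗ X)%obj ->
  unsandwich sS f @ dX = (mX # mX) @ ((sS # ((f @ dX) # sS)) @ ((dX # x) @ dX)).
Proof.
case: f => A B f /= eA eB; subst A B; set g := Arr f.
rewrite /unsandwich -!acompA; try arr_ty.
rewrite arr_coass4 (acompA (f := (dX # x) @ dX)); try arr_ty.
by rewrite atensA acomp3 //= !acompf1.
Qed.

End Antipode.

(** * From cancellation to transparency and cocommutativity *)

Hypothesis hopf : is_hopf H.

Lemma sandwich_inj f g :
  adom f = (X ⊗ X)%obj -> acod f = (X ⊗ X)%obj ->
  adom g = (X ⊗ X)%obj -> acod g = (X ⊗ X)%obj ->
  sandwich f = sandwich g -> f = g.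
Proof.
move=> df cf dg cg E; have [S [SX XS]] := hopf.
by rewrite -(sandwichK SX XS df cf) E sandwichK.
Qed.

Lemma sandwich_Delta_inj f g :
  adom f = (X ⊗ X)%obj -> acod f = (X ⊗ X)%obj ->
  adom g = (X ⊗ X)%obj -> acod g = (X ⊗ X)%obj ->
  sandwich f @ dX = sandwich g @ dX -> f @ dX = g @ dX.
Proof.
move=> df cf dg cg E; have [S [SX XS]] := hopf.
rewrite -(sandwichK SX XS df cf) -(sandwichK SX XS dg cg).
rewrite (unsandwich_comp S (adom_sandwich f) (acod_sandwich df cf)) E.
by rewrite -(unsandwich_comp S (adom_sandwich g) (acod_sandwich dg cg)).
Qed.

Lemma cocomm_transparent : cocommutative (bim_com H) -> transparent X X.
Proof.
move=> /arr_cocommP cH; rewrite /transparent.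
have [t [ts st]] := braid_iso X X.
have tE : Arr t @ sX = aid (X ⊗ X)%obj by rewrite -Arr_comp ts.
have Et : sX @ Arr t = aid (X ⊗ X)%obj by rewrite -Arr_comp st.
suff E : sX = Arr t by rewrite {1}E.
apply: sandwich_inj => //.
(* [sandwich sX] is [dX @ mX], which [sX] fixes by cocommutativity; cancelling the invertible [sX]
   then equates the two sandwiches. *)
suff E : sX @ sandwich (Arr t) = sandwich sX.
  have Esw : sX @ sandwich sX = sandwich sX.
    by rewrite -arr_bialgebra acompA // cH.
  have := congr1 (acomp (Arr t)) (etrans E (esym Esw)).
  have cancel a : acod a = (X ⊗ X)%obj -> Arr t @ (sX @ a) = a.
    by move=> ca; rewrite acompA // tE acomp1f.
  by rewrite !cancel ?acod_sandwich // => ->.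
rewrite /sandwich acompA; try arr_ty.
(* Moved below the products, [sX] becomes the braiding of two pairs: its first crossing cancels [t],
   the next two are absorbed by [dX # dX], and the last one is the filling of [sandwich sX]. *)
rewrite (s_nat mX mX) /= s_tens !atensA.
rewrite -!acompA; try arr_ty.
rewrite (acompA (g := x # (Arr t # x))); try arr_ty.
rewrite -atens_compl; try arr_ty.
rewrite -atens_compr; try arr_ty.
rewrite Et (atens_id X X) (atensA x x) -(atensA x x) -!atens_id acomp1f; try arr_ty.
by rewrite acomp2 // cH.
Qed.

Lemma clone_cocomm : endo_is_clone (bim_com H) -> cocommutative (bim_com H).
Proof.
case=> pi [bullet [_ bulletE _]]; apply/arr_cocommP.
(* Powers end in a factor [unit]: up to strictness, [phi] is the multiplication and both entries of
   [psi] are the identity. *)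
pose phi : endo (bim_com H) 2 := mu H ∘ (idm _ ⊗ eqto (tenso1 (bim_com H : Com C))).
pose psi (i : 'I_2) : endo (bim_com H) 1 := eqto (tenso1 (bim_com H : Com C)).
have := com_morP (bullet _ _ phi psi); rewrite bulletE.
have tE : tpow (bim_com H : Com C) 1 = bim_com H by exact: tenso1.
have DE : Arr (Delta (tpow (bim_com H : Com C) 1)) = dX by rewrite tE.
have eE : Arr (eps (tpow (bim_com H : Com C) 1)) = eX by rewrite tE.
have idE : Arr (com_mor (eqto (tenso1 (bim_com H : Com C)))) = x.
  exact: etrans (Arr_com_eqto _) (congr1 _ (tenso1 _)).
have psiE i : Arr (com_mor (psi i)) = x by exact: idE.
have phiE : Arr (com_mor phi) = mX.
  transitivity (mX @ (x # Arr (com_mor (eqto (tenso1 (bim_com H : Com C)))))).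
    exact: Arr_comp.
  by rewrite idE -atens_id acompf1.
have supE : Arr (superpose phi psi) = mX @ dX.
  transitivity (Arr (com_mor phi) @ Arr (tuple_hom psi)).
    by rewrite -Arr_comp /tuple_hom compA.
  rewrite phiE !Arr_tuple_homS tuple_hom0 eE DE.
  by rewrite !(psiE, arr_counitr) -atens_id acomp1f.
move=> /arr_homP[]; rewrite supE DE => E _.
(* The bialgebra axiom produces the crossing on the left; the right side of [E] multiplies adjacent
   legs, without crossing. *)
have {E} : sandwich sX @ dX = sandwich (x # x) @ dX.
  rewrite -arr_bialgebra -acompA // E -acomp2 // /sandwich.
  rewrite -!atens_id (acomp1f (f := dX # dX)); arr_ty.
move=> /sandwich_Delta_inj -> //; by rewrite -atens_id acomp1f.
Qed.

End Hopf.

Theorem proposition3p14 (C : braided) (H : hopf_monoid C) :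
  endo_is_clone (bim_com H) <-> cocommutative (bim_com H).
Proof.
split=> [|cH]; first exact: clone_cocomm (hopfP H).
exact: cocomm_clone (cocomm_transparent (hopfP H) cH) cH.
Qed.
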